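(* For all $k\geq 3$, $$\sum_{n\geq0}I^e_{23\cdots k1;1}(n)\,x^n=\frac{x^3}{1-x}\sum_{n\geq0}I^o_{12\cdots(k-2);1}(n)\,x^n.$$
   Context: $23\cdots k1$ denotes the permutation $(2,3,\dots,k,1)$ of length $k$, and $12\cdots m$ the identity permutation of length $m$. For a pattern $\tau$ and $r\geq0$, $I^e_{\tau;r}(n)$ (resp. $I^o_{\tau;r}(n)$) is the number of even (resp. odd) involutions $\pi\in\mathfrak{S}_n$ (i.e. $\pi=\pi^{-1}$; even/odd refers to the parity of the number of inversions, pairs $i<j$ with $\pi_i>\pi_j$) that avoid $132$ and contain $\tau$ exactly $r$ times (an occurrence of $\tau\in\mathfrak{S}_m$ is an index set $i_1<\dots<i_m$ with $\pi_{i_1}\cdots\pi_{i_m}$ order-isomorphic to $\tau$). *)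

(* Defs.v *)
From mathcomp Require Import all_boot all_order all_fingroup all_algebra.

Set Implicit Arguments.
Unset Strict Implicit.
Unset Printing Implicit Defensive.

Import GRing.Theory.

(* Permutations of length n are elements of 'S_n = {perm 'I_n}, so positions
   and values run over 0, ..., n-1 instead of 1, ..., n. *)

Definition involution n (s : 'S_n) : bool := (s^-1)%g == s.

Definition inversions n (s : 'S_n) : {set 'I_n * 'I_n} :=
  [set p : 'I_n * 'I_n | (p.1 < p.2)%N && (s p.2 < s p.1)%N].

Definition even_permutation n (s : 'S_n) : bool := ~~ odd #|inversions s|.
Definition odd_permutation n (s : 'S_n) : bool := odd #|inversions s|.

(* An index set i_1 < ... < i_m is encoded as the strictly increasing map
   f : j |-> i_j. *)
Definition occurrences m n (t : 'S_m) (s : 'S_n) : {set {ffun 'I_m -> 'I_n}} :=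
  [set f : {ffun 'I_m -> 'I_n} |
    [forall a : 'I_m, forall b : 'I_m, (a < b)%N ==> (f a < f b)%N]
    && [forall a : 'I_m, forall b : 'I_m, (s (f a) < s (f b))%N == (t a < t b)%N]].

Definition contains_exactly m n (t : 'S_m) (r : nat) (s : 'S_n) : bool :=
  #|occurrences t s| == r.

Definition avoids m n (t : 'S_m) (s : 'S_n) : bool := occurrences t s == set0.

Definition pattern132 : 'S_3 :=
  tperm (@Ordinal 3 1 isT) (@Ordinal 3 2 isT).

(* 2 3 ... k 1: the entry at position i is i + 1 modulo k. *)
Definition pattern23k1 (k : nat) : 'S_k := perm (@ordS_inj k).

Definition pattern_id (m : nat) : 'S_m := 1%g.

Definition I_even m (t : 'S_m) (r n : nat) : nat :=
  #|[set s : 'S_n | [&& involution s, even_permutation s,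
                        avoids pattern132 s & contains_exactly t r s]]|.

Definition I_odd m (t : 'S_m) (r n : nat) : nat :=
  #|[set s : 'S_n | [&& involution s, odd_permutation s,
                        avoids pattern132 s & contains_exactly t r s]]|.

Local Open Scope ring_scope.

(* Formal power series, as coefficient sequences; equality is =1. *)
Definition fps (F : fieldType) : Type := nat -> F.

Section FormalPowerSeries.
Variable F : fieldType.
Implicit Types f g : fps F.

Definition fps_of_poly (p : {poly F}) : fps F := fun n => p`_n.

Definition fps_mul f g : fps F :=
  fun n => \sum_(i < n.+1) f i * g (n - i)%N.

(* The first n coefficients of 1 / f, by solving f * g = 1 degree by degree;
   meaningful only when f 0 != 0. *)
Fixpoint fps_inv_coefs f (n : nat) : seq F :=
  if n is n'.+1 then
    let s := fps_inv_coefs f n' in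
    rcons s (((n' == 0)%N%:R - \sum_(i < n') f (n' - i)%N * s`_i) / f 0%N)
  else [::].

Definition fps_inv f : fps F := fun n => (fps_inv_coefs f n.+1)`_n.

Definition fps_div f g : fps F := fps_mul f (fps_inv g).

Lemma size_fps_inv_coefs f n : size (fps_inv_coefs f n) = n.
Proof. by elim: n => //= n IHn; rewrite size_rcons IHn. Qed.

Lemma nth_fps_inv_coefs f n i :
  (i < n)%N -> (fps_inv_coefs f n)`_i = fps_inv f i.
Proof.
elim: n => // n IHn; rewrite ltnS leq_eqVlt => /predU1P[-> //|lt_in].
by rewrite /= nth_rcons size_fps_inv_coefs lt_in IHn.
Qed.

Lemma fps_mulV f :
  f 0%N != 0 -> fps_mul f (fps_inv f) =1 fps_of_poly 1.
Proof.
move=> f0 n; rewrite /fps_mul big_ord_recl subn0 /fps_of_poly coef1.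
rewrite {1}/fps_inv /= nth_rcons size_fps_inv_coefs ltnn eqxx.
rewrite mulrCA divff // mulr1 [X in _ + X](reindex_inj rev_ord_inj) /=.
under [X in _ + X]eq_bigr => i _.
  rewrite /bump add1n subnSK // subKn; last exact: ltnW.
  rewrite -(nth_fps_inv_coefs f (ltn_ord i)).
  over.
by rewrite subrK.
Qed.

End FormalPowerSeries.

Definition gen_series (a : nat -> nat) : fps rat := fun n => (a n)%:R.

(* Main.v *)
(** Every involution [s] counted on the left is, up to a tail of fixed points at
the top end, a [132]-avoiding involution [t] to which a fixed point is appended
above and to the right, the result being enclosed between a new leading maximum
and a new trailing minimum (so [s] is [N (t+1) l 0] with [l = N - 1]).
Occurrences of [2 3 .. k 1] in [s] then come from occurrences of [1 2 .. k-2] in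
[t], extended by [l] and by the trailing minimum. Enclosing adds an odd number
of inversions and three entries, which gives the factor [x^3] and exchanges even
and odd; the tail of fixed points gives [1 / (1 - x)].

The shape of [s] is forced by uniqueness. A [132]-avoiding permutation has all
entries before its maximum larger than all entries after it, so an occurrence
usually admits several choices for its smallest entry; and since [s] is an
involution, the images of the entries [2 .. k] of an occurrence form another
increasing sequence, which often completes to a second occurrence. *)

Require Import Defs.
From mathcomp Require Import all_boot all_order all_fingroup all_algebra.
From mathcomp Require Import zify.

Import GRing.Theory.

(** * Occurrences of the patterns as sequences of positions *)

Definition rising {n} (s : 'S_n) : rel 'I_n := fun a b => (a < b) && (s a < s b).

Definition falling {n} (s : 'S_n) : rel 'I_n := fun a b => (a < b) && (s b < s a).

(* [p] lists the positions of the entries 2, .., k, and [x] is that of the entry 1. *)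
Definition occurs_23k1 {n} (s : 'S_n) (p : seq 'I_n) (x : 'I_n) : bool :=
  pairwise (rising s) p && all ((falling s)^~ x) p.

(** Pairs [a < b] suffice: [f] is then injective, so the values of [s] and of [t] at distinct
    indices never tie and the reversed comparison is the negation. *)
Lemma occurrencesP m n (t : 'S_m) (s : 'S_n) (f : {ffun 'I_m -> 'I_n}) :
  reflect (forall a b : 'I_m, a < b -> f a < f b /\ (s (f a) < s (f b)) = (t a < t b))
          (f \in occurrences t s).
Proof.
rewrite inE; apply: (iffP andP) => [[/forallP mono /forallP iso] a b lt_ab | occ].
  split; first by have /forallP/(_ b)/implyP/(_ lt_ab) := mono a.
  by have /forallP/(_ b)/eqP := iso a.
split; apply/forallP => a; apply/forallP => b.
  by apply/implyP => /occ[].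
apply/eqP; case: (ltngtP a b) => [/occ[] //|lt_ba|/val_inj ->]; last by rewrite !ltnn.
have [lt_f eq_s] := occ _ _ lt_ba.
have neq_sf : s (f a) != s (f b) :> nat.
  by rewrite (inj_eq val_inj) (inj_eq perm_inj) -(inj_eq val_inj) gtn_eqF.
have neq_t : t a != t b :> nat.
  by rewrite (inj_eq val_inj) (inj_eq perm_inj) -(inj_eq val_inj) gtn_eqF.
lia.
Qed.

Lemma tuple_pairwiseP (T : Type) (r : rel T) m (p : m.-tuple T) :
  reflect (forall i j : 'I_m, i < j -> r (tnth p i) (tnth p j)) (pairwise r p).
Proof.
case: m p => [|m] p; first by rewrite tuple0; left; case.
pose x0 := tnth p ord0.
apply: (iffP (pairwiseP x0)) => pw i j.
  by rewrite !(tnth_nth x0) => ?; apply: pw; rewrite // inE size_tuple.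
rewrite !inE size_tuple => lt_i lt_j lt_ij.
by have := pw (Ordinal lt_i) (Ordinal lt_j) lt_ij; rewrite !(tnth_nth x0).
Qed.

Lemma occurrences_id m n (s : 'S_n) (p : m.-tuple 'I_n) :
  ([ffun i => tnth p i] \in occurrences (pattern_id m) s) = pairwise (rising s) p.
Proof.
apply/occurrencesP/tuple_pairwiseP => occ i j lt_ij.
  by have [] := occ i j lt_ij; rewrite !ffunE !perm1 /rising lt_ij => -> ->.
by have /andP[lt_p lt_s] := occ i j lt_ij; rewrite !ffunE !perm1 lt_ij lt_p lt_s.
Qed.

(** The successor modulo [m + 1] is increasing except at the last position, which wraps around to
    0. *)
Lemma pattern23k1_lt m (a b : 'I_m.+1) : a < b ->
  (pattern23k1 m.+1 a < pattern23k1 m.+1 b) = (b < m).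
Proof.
move=> lt_ab; rewrite !permE /=; have := ltn_ord b; rewrite ltnS => le_bm.
rewrite modn_small; last by lia.
case: (ltnP b m) => [lt_bm | le_mb]; first by rewrite modn_small; lia.
have -> : b = m :> nat by lia.
by rewrite modnn.
Qed.

Lemma occurrences_23k1 m n (s : 'S_n) (p : m.-tuple 'I_n) (x : 'I_n) :
  ([ffun i => tnth [tuple of rcons p x] i] \in occurrences (pattern23k1 m.+1) s)
  = occurs_23k1 s p x.
Proof.
have nthS i : nth x (rcons p x) i = nth x p i.
  rewrite nth_rcons size_tuple; case: ltngtP => // [?|->];
    by rewrite nth_default ?size_tuple // ltnW.
apply/occurrencesP/andP => [occ | [/(pairwiseP x) pw /(all_nthP x) fa] a b lt_ab].
  split.
    apply/(pairwiseP x) => i j; rewrite !inE !size_tuple => lt_i lt_j lt_ij.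
    have [] := occ (Ordinal (ltnW lt_i : i < m.+1)) (Ordinal (ltnW lt_j : j < m.+1)) lt_ij.
    by rewrite !ffunE !(tnth_nth x) /= !nthS /rising => -> ->; rewrite pattern23k1_lt.
  apply/(all_nthP x) => i; rewrite size_tuple => lt_i.
  have [] := occ (Ordinal (ltnW lt_i : i < m.+1)) ord_max lt_i.
  rewrite !ffunE !(tnth_nth x) /= !nthS pattern23k1_lt //= ltnn /falling.
  rewrite (@nth_default _ x p m) ?size_tuple // => lt_x; rewrite lt_x /=.
  have neq_s : s (nth x p i) != s x :> nat.
    by rewrite (inj_eq val_inj) (inj_eq perm_inj) -(inj_eq val_inj) ltn_eqF.
  by case: ltngtP neq_s.
rewrite !ffunE !(tnth_nth x) /= !nthS pattern23k1_lt //.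
have := ltn_ord b; rewrite ltnS leq_eqVlt => /predU1P[eq_b | lt_b].
  rewrite eq_b (@nth_default _ x p m) ?size_tuple // ltnn.
  have /fa/andP[-> lt_s] : a < size p by rewrite size_tuple; lia.
  by rewrite ltnNge ltnW.
have mem_p i : i < m -> i \in [pred j | j < size p] by rewrite inE size_tuple.
have /andP[-> ->] := pw a b (mem_p _ (ltn_trans lt_ab lt_b)) (mem_p _ lt_b) lt_ab.
by rewrite lt_b.
Qed.

Lemma card1P (T : finType) (A : {set T}) :
  reflect (exists! x, x \in A) (#|A| == 1).
Proof.
apply: (iffP cards1P) => [[x ->] | [x [Ax uniq_x]]]; exists x.
  by split=> [|y]; rewrite ?set11 // => /set1P.
by apply/setP=> y; rewrite inE; apply/idP/eqP => [/uniq_x | ->].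
Qed.

Lemma contains_id_onceP m n (s : 'S_n) :
  reflect (exists! p, size p = m /\ pairwise (rising s) p)
          (contains_exactly (pattern_id m) 1 s).
Proof.
have tupE (f : {ffun 'I_m -> 'I_n}) : f = [ffun i => tnth (mktuple f) i].
  by apply/ffunP=> i; rewrite ffunE tnth_mktuple.
rewrite /contains_exactly; apply: (iffP (card1P _ _)) =>
  [[f [+ uniq_f]] | [p [[sz_p pw_p] uniq_p]]].
  rewrite (tupE f) occurrences_id => pw_f; exists (mktuple f).
  split=> [|p [/eqP sz_p pw_p]]; first by rewrite size_tuple.
  rewrite (_ : f = [ffun i => tnth (Tuple sz_p) i]); first last.
    by apply: uniq_f; rewrite occurrences_id.
  rewrite -[p]/(tval (Tuple sz_p)); congr tval.
  by apply: eq_from_tnth => i; rewrite tnth_mktuple ffunE.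
move/eqP: sz_p => sz_p; exists [ffun i => tnth (Tuple sz_p) i].
split=> [|g]; first by rewrite occurrences_id.
rewrite (tupE g) occurrences_id => pw_g; apply/ffunP=> i; rewrite !ffunE.
congr (tnth _ i); apply: val_inj.
by apply: (uniq_p (tval (mktuple g))); rewrite size_tuple.
Qed.

Lemma contains_23k1_onceP m n (s : 'S_n) :
  reflect (exists! px : seq 'I_n * 'I_n, size px.1 = m /\ occurs_23k1 s px.1 px.2)
          (contains_exactly (pattern23k1 m.+1) 1 s).
Proof.
have tupE (f : {ffun 'I_m.+1 -> 'I_n}) :
    exists (p : m.-tuple 'I_n) x, f = [ffun i => tnth [tuple of rcons p x] i].
  have: size (codom f) = m.+1 by rewrite size_codom card_ord.
  move def_c: (codom f) => c; case/lastP: c def_c => // p x def_f.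
  rewrite size_rcons => -[/eqP sz_p].
  exists (Tuple sz_p), x; apply/ffunP => i; rewrite ffunE (tnth_nth x) /= -def_f.
  by rewrite codomE (nth_map i) ?size_enum_ord // nth_ord_enum.
have occ_inj (p q : m.-tuple 'I_n) x y :
    [ffun i => tnth [tuple of rcons p x] i] = [ffun i => tnth [tuple of rcons q y] i] ->
    (tval p, x) = (tval q, y).
  move/ffunP => eq_f; have: [tuple of rcons p x] = [tuple of rcons q y].
    by apply: eq_from_tnth => i; have:= eq_f i; rewrite !ffunE.
  by case/(congr1 val)/rcons_inj => -> ->.
rewrite /contains_exactly; apply: (iffP (card1P _ _)) =>
  [[f [+ uniq_f]] | [[p x] [/= [sz_p occ_p] uniq_p]]].
  have [p [x def_f]] := tupE f.
  rewrite def_f occurrences_23k1 => occ_f; exists (tval p, x).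
  split=> [|[q y] /= [/eqP sz_q occ_q]]; first by rewrite size_tuple.
  rewrite -[q]/(tval (Tuple sz_q)); apply: occ_inj; rewrite -def_f; apply: uniq_f.
  by rewrite occurrences_23k1.
move/eqP: sz_p => sz_p; exists [ffun i => tnth [tuple of rcons (Tuple sz_p) x] i].
split=> [|g]; first by rewrite occurrences_23k1.
have [q [y ->]] := tupE g; rewrite occurrences_23k1 => occ_q.
have [eq_p eq_x] : (p, x) = (tval q, y) by apply: uniq_p; rewrite size_tuple.
by apply/ffunP=> i; rewrite !ffunE; congr (tnth _ i); apply: val_inj; rewrite /= eq_p eq_x.
Qed.

Lemma avoids132P n (s : 'S_n) :
  reflect (forall a b c : 'I_n, a < b -> b < c -> s a < s c -> s b < s c)
          (avoids pattern132 s).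
Proof.
pose i0 := @Ordinal 3 0 isT; pose i1 := @Ordinal 3 1 isT; pose i2 := @Ordinal 3 2 isT.
have [t0 t1 t2] : [/\ pattern132 i0 = i0, pattern132 i1 = i2 & pattern132 i2 = i1].
  by split; rewrite /pattern132 permE.
apply: (iffP eqP) => [av a b c lt_ab lt_bc lt_s | av].
  rewrite ltnNge; apply/negP => le_s.
  have {le_s} lt_s' : s c < s b.
    by rewrite ltn_neqAle le_s (inj_eq val_inj) (inj_eq perm_inj) -(inj_eq val_inj) gtn_eqF.
  suff: [ffun i => tnth [tuple a; b; c] i] \in occurrences pattern132 s by rewrite av inE.
  apply/occurrencesP => i j; rewrite !ffunE !(tnth_nth a).
  case: i => -[|[|[|//]]] hi; case: j => -[|[|[|//]]] hj //= _.
  + by rewrite !permE /=; lia.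
  + by rewrite !permE /=; lia.
  + by rewrite !permE /=; lia.
apply/setP => f; rewrite in_set0; apply/negP => /occurrencesP occ.
have [lt01 _] := occ i0 i1 isT.
have [lt12 s12] := occ i1 i2 isT.
have [lt02 s02] := occ i0 i2 isT.
move: s12 s02; rewrite t0 t1 t2 /= => s12 s02.
by have := av _ _ _ lt01 lt12 s02; rewrite s12.
Qed.

(** * Inserting and removing one entry of a permutation *)

Lemma lift_perm_inj n (i j : 'I_n.+1) : injective (@lift_perm n i j).
Proof.
move=> s t eq_st; apply/permP => k; apply: (@lift_inj _ j).
by rewrite -!(lift_perm_lift i) eq_st.
Qed.

Lemma lift_perm_surj n (s : 'S_n.+1) (i j : 'I_n.+1) :
  s i = j -> exists t, s = lift_perm i j t.
Proof.
move=> sij; have ex k : exists l, s (lift i k) == lift j l.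
  case: (unliftP j (s (lift i k))) => [l ->|]; first by exists l.
  by rewrite -sij => /perm_inj/eqP; rewrite eq_sym (negPf (neq_lift _ _)).
pose f k := xchoose (ex k).
have fE k : s (lift i k) = lift j (f k) by apply/eqP; apply: (xchooseP (ex k)).
have f_inj : injective f.
  by move=> k l /(congr1 (lift j)); rewrite -!fE => /perm_inj/lift_inj.
exists (perm f_inj); apply/permP => k; case: (unliftP i k) => [l|] ->.
  by rewrite lift_perm_lift permE fE.
by rewrite lift_perm_id.
Qed.

(** * Involutions with a unique occurrence of [2 3 .. k 1] *)

Lemma involutionP n (s : 'S_n) : reflect (involutive s) (involution s).
Proof.
apply: (iffP eqP) => [sV x | sK]; first by rewrite -{1}sV permK.
by apply/permP => x; apply: (@perm_inj _ s); rewrite permKV sK.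
Qed.

(** In a rising sequence the last position is the rightmost one and the first value the smallest
    one, so these two bound all the others. *)
Lemma occurs_23k1E n (s : 'S_n) a q b x : pairwise (rising s) (a :: rcons q b) ->
  occurs_23k1 s (a :: rcons q b) x = (b < x) && (s x < s a).
Proof.
move=> pw; rewrite /occurs_23k1 pw.
move: pw; rewrite /= all_rcons pairwise_rcons all_rcons.
case/andP=> /andP[/andP[lt_ab lt_sab] /allP ra] /andP[/allP rb _].
apply/andP/andP => [[/andP[_ lt_xa] /andP[/andP[lt_bx _] _]] | [lt_bx lt_xa]] //.
split; first by rewrite /falling lt_xa (ltn_trans lt_ab).
rewrite /falling lt_bx (ltn_trans lt_xa) //=.
apply/allP => c qc; have /andP[lt_ac lt_sac] := ra c qc.
have /andP[lt_cb lt_scb] := rb c qc.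
by rewrite (ltn_trans lt_cb) // (ltn_trans lt_xa).
Qed.

(** An involution exchanges positions and values, and [rising] is symmetric in the two. This
    supplies the second candidate occurrence. *)
Lemma rising_involution n (s : 'S_n) (p : seq 'I_n) :
  involutive s -> pairwise (rising s) (map s p) = pairwise (rising s) p.
Proof.
by move=> sK; rewrite pairwise_map; apply: eq_pairwise => a b; rewrite /= /rising !sK andbC.
Qed.

(* [last_uniq] uses that the smallest entry of the occurrence is determined by
   the others, [mirror] that the other entries cannot be replaced by their images. *)
Lemma unique_occurrence_shape N (s : 'S_N.+1) (p : seq 'I_N.+1) (x : 'I_N.+1) :
    involutive s -> 1 < size p ->
    (forall a b c : 'I_N.+1, a < b -> b < c -> s a < s c -> s b < s c) ->
    occurs_23k1 s p x ->
    (forall q y, size q = size p -> occurs_23k1 s q y -> (p, x) = (q, y)) ->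
    s ord_max != ord_max ->
  [/\ 1 < N, s ord0 = ord_max & forall l : 'I_N.+1, l.+1 = N -> s l = l].
Proof.
move=> sK; case: p => // a p; case/lastP: p => // q b _ av occ uniq_occ sN_neq.
have /andP[pw _] := occ.
move: occ; rewrite occurs_23k1E // => /andP[lt_bx lt_xa].
have /andP[lt_ab lt_sab] : rising s a b.
  by move: pw; rewrite /= all_rcons => /andP[/andP[]].
have last_uniq (z : 'I_N.+1) : b < z -> s z < s a -> z = x.
  move=> lt_bz lt_za; apply/esym.
  suff /(congr1 snd) : (a :: rcons q b, x) = (a :: rcons q b, z) by [].
  by apply: uniq_occ; rewrite ?occurs_23k1E ?lt_bz.
have mirror (z : 'I_N.+1) : s b < z -> s z < a -> s a = a.
  move=> lt_bz lt_za.
  suff [<-] : (a :: rcons q b, x) = (map s (a :: rcons q b), z) by [].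
  apply: uniq_occ; first by rewrite size_map.
  move: pw; rewrite -(rising_involution _ _ _ sK) /= map_rcons => pw_s.
  by rewrite occurs_23k1E // sK lt_bz.
have valE (c d : 'I_N.+1) : c = d :> nat -> c = d by move/val_inj.
have ltS (c : 'I_N.+1) : c <= N by rewrite -ltnS.
have sE (c d : 'I_N.+1) : s c = d :> nat -> c = s d by move/valE <-; rewrite sK.
have lt_bN := leq_trans lt_bx (ltS x).
set m := s ord_max; have sm : s m = ord_max by rewrite /m sK.
have lt_mN : m < N.
  by have := ltS m; rewrite leq_eqVlt => /predU1P[/(valE m ord_max)/eqP|//]; rewrite (negPf sN_neq).
(* The maximum sits at position [m]; [s c < s d] would make the positions [c], [m], [d] an
   occurrence of 132. *)
have above (c d : 'I_N.+1) : c < m -> m < d -> s d < s c.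
  move=> lt_cm lt_md; rewrite ltnNge leq_eqVlt; apply/negP => /predU1P[|lt_s].
    by move/val_inj/perm_inj => eq_cd; rewrite eq_cd in lt_cm; lia.
  have := av c m d lt_cm lt_md lt_s; rewrite sm /=; have := ltS (s d); lia.
(* If [a < m], both [ord_max] and [s a] can serve as the position of the smallest entry; they
   coincide, which forces [a = m]. *)
have lt_ma : m < a.
  rewrite ltnNge leq_eqVlt; apply/negP => /predU1P[/val_inj eq_am | lt_am].
    by move: lt_sab; rewrite eq_am sm /=; have := ltS (s b); lia.
  have le_bm : b <= m.
    by rewrite leqNgt; apply/negP => /(above _ _ lt_am); lia.
  have lt_sNa : m < s a by apply: (above a ord_max).
  have xN : ord_max = x by apply: last_uniq => //=.
  have xsa : s a = x.
    by apply: last_uniq; [apply: leq_ltn_trans lt_sNa | apply: above].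
  by move: lt_am; rewrite (_ : a = m) ?ltnn // /m xN -xsa sK.
(* If [s a < m], the images of the positions together with [ord_max] form an occurrence, so
   [s a = a], against [m < a]. *)
have lt_msa : m < s a.
  rewrite ltnNge leq_eqVlt; apply/negP => /predU1P[/sE | lt_sam].
    by rewrite sm => eq_a; rewrite eq_a /= in lt_ab; have := ltS b; lia.
  have eq_sa : s a = a.
    apply: (mirror ord_max) => //=.
    have := ltS (s b); rewrite leq_eqVlt => /predU1P[/(valE _ ord_max)/(congr1 val)/sE|//].
    by rewrite -/m => eq_b; rewrite eq_b in lt_ab; lia.
  by rewrite eq_sa in lt_sam; lia.
have xN : ord_max = x by apply: last_uniq.
have s0 : s ord0 = ord_max.
  case: (posnP m) => [m0 | m_gt0]; first by rewrite -sm; congr (s _); apply: valE.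
  (* The position [s ord0] carries the value 0 and, by [above], lies to the right of [b]; so it can
     hold the smallest entry. *)
  rewrite xN; apply: last_uniq; last by rewrite sK /=; lia.
  by rewrite -{1}(sK b); apply: above => //; apply: ltn_trans lt_sab.
have sN : s ord_max = ord0 by rewrite -s0 sK.
split=> // [|l lN]; first by lia.
apply/eqP/negP => /negP neq_sl.
have sml : s (s l) = l by rewrite sK.
have lt_ml : s l < l.
  have neq_val : s l != l :> nat by rewrite (inj_eq val_inj).
  suff: s l != N :> nat by have := ltS (s l); lia.
  apply/eqP => /(sE l ord_max); rewrite sN => l0; rewrite l0 /= in lN; lia.
(* The value [l], at position [s l], is exceeded only by the maximum, now known to be at position 0;
   the argument for [above] then applies to [l]. *)
have above_l (c d : 'I_N.+1) : c < s l -> s l < d -> s d < s c.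
  move=> lt_cm lt_md; rewrite ltnNge leq_eqVlt; apply/negP => /predU1P[|lt_s].
    by move/val_inj/perm_inj => eq_cd; rewrite eq_cd in lt_cm; lia.
  have := av c (s l) d lt_cm lt_md lt_s; rewrite sml => lt_ld.
  have: s d = N :> nat by have := ltS (s d); lia.
  by move/(sE d ord_max); rewrite sN => d0; rewrite d0 in lt_md.
have lt_sal : s a < s l.
  rewrite ltnNge leq_eqVlt; apply/negP => /predU1P[/val_inj/perm_inj eq_la | lt_sl].
    by rewrite eq_la in lN; lia.
  have: b <= l by lia.
  rewrite leq_eqVlt => /predU1P[/val_inj eq_bl | lt_bl].
    by rewrite eq_bl in lt_sab; lia.
  by have eq_lx := last_uniq l lt_bl lt_sl; move: lN; rewrite eq_lx -xN /=; lia.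
have lt_la : s l < a.
  rewrite ltnNge leq_eqVlt; apply/negP => /predU1P[/val_inj eq_al | lt_al].
    by rewrite {1}eq_al sml in lt_sal; lia.
  by have := above_l a l lt_al lt_ml; lia.
(* Mirroring with [ord_max], whose value is 0, makes [a] a fixed point, which contradicts
   [s a < s l < a]. *)
have eq_sa : s a = a.
  apply: (mirror ord_max); last by rewrite sN /=; lia.
  have := ltS (s b); rewrite leq_eqVlt => /predU1P[/(sE b ord_max)|//].
  by rewrite sN => b0; rewrite b0 in lt_ab.
by rewrite eq_sa in lt_sal; lia.
Qed.

(** * The two constructions: appending a fixed maximum, and enclosing *)

Definition extend_max {n} (t : 'S_n) : 'S_n.+1 := lift_perm ord_max ord_max t.

Definition enclose {n} (t : 'S_n) : 'S_n.+3 :=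
  lift_perm ord0 ord_max (lift_perm ord_max ord0 (extend_max t)).

Definition inner {n} (i : 'I_n) : 'I_n.+3 := lift ord0 (lift ord_max (lift ord_max i)).

Definition enclose_fixpoint {n} : 'I_n.+3 := lift ord0 (lift ord_max ord_max).

Lemma innerE n (i : 'I_n) : inner i = i.+1 :> nat.
Proof. by rewrite lift0 !lift_max. Qed.

Lemma enclose_fixpointE n : @enclose_fixpoint n = n.+1 :> nat.
Proof. by rewrite lift0 lift_max. Qed.

Lemma inner_inj n : injective (@inner n).
Proof. by move=> i j /lift_inj/lift_inj/lift_inj. Qed.

Variant enclose_spec {n} : 'I_n.+3 -> Prop :=
  | EncloseFirst : enclose_spec ord0
  | EncloseInner i : enclose_spec (inner i)
  | EncloseFixpoint : enclose_spec enclose_fixpoint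
  | EncloseLast : enclose_spec ord_max.

Lemma encloseP n (y : 'I_n.+3) : enclose_spec y.
Proof.
case: (unliftP ord0 y) => [z|] ->; last exact: EncloseFirst.
case: (unliftP ord_max z) => [w|] ->.
  case: (unliftP ord_max w) => [i|] ->; first exact: EncloseInner.
  exact: EncloseFixpoint.
rewrite (_ : lift _ _ = ord_max); first exact: EncloseLast.
by apply: ord_inj; rewrite /= /bump.
Qed.

Section Enclose.
Variables (n : nat) (t : 'S_n).

Lemma enclose_first : enclose t ord0 = ord_max.
Proof. exact: lift_perm_id. Qed.

Lemma enclose_inner i : enclose t (inner i) = inner (t i).
Proof.
rewrite !lift_perm_lift; apply: ord_inj; rewrite innerE lift_max lift0.
by rewrite lift_max.
Qed.

Lemma enclose_fix : enclose t enclose_fixpoint = enclose_fixpoint.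
Proof.
rewrite !lift_perm_lift lift_perm_id; apply: ord_inj.
by rewrite enclose_fixpointE lift_max lift0.
Qed.

Lemma enclose_last : enclose t ord_max = ord0.
Proof.
rewrite (_ : ord_max = lift ord0 ord_max); last by apply: ord_inj; rewrite /= /bump.
by rewrite lift_perm_lift lift_perm_id; apply: ord_inj; rewrite lift_max.
Qed.

Definition encloseE := (enclose_first, enclose_inner, enclose_fix, enclose_last).

End Enclose.

Lemma enclose_surj n (s : 'S_n.+3) :
    s ord0 = ord_max -> s ord_max = ord0 -> s enclose_fixpoint = enclose_fixpoint ->
  exists t, s = enclose t.
Proof.
move=> /lift_perm_surj[u ->] sN sl.
have /lift_perm_surj[v def_u] : u ord_max = ord0.
  apply: (@lift_inj _ ord_max); rewrite -(lift_perm_lift ord0).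
  rewrite (_ : lift ord0 _ = ord_max); last by apply: ord_inj; rewrite /= /bump.
  by rewrite sN; apply: ord_inj; rewrite lift_max.
have /lift_perm_surj[t def_v] : v ord_max = ord_max.
  apply: (@lift_inj _ ord0); rewrite -(lift_perm_lift ord_max) -def_u.
  apply: (@lift_inj _ ord_max); rewrite -(lift_perm_lift ord0) sl.
  by apply: ord_inj; rewrite enclose_fixpointE lift_max lift0.
by exists t; rewrite def_u def_v.
Qed.

Lemma enclose_involution n (t : 'S_n) : involution (enclose t) = involution t.
Proof.
apply/involutionP/involutionP => [sK i | tK y].
  by apply: inner_inj; rewrite -!enclose_inner sK.
by case: (encloseP _ y) => [|i||]; rewrite !encloseE ?tK.
Qed.

(** No new entry can take part in 132: a leading maximum and a trailing minimum fit none of its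
    roles, and the fixed point is exceeded only by the first entry and followed only by the last. *)
Lemma enclose_avoids132 n (t : 'S_n) :
  avoids pattern132 (enclose t) = avoids pattern132 t.
Proof.
apply/avoids132P/avoids132P => av a b c.
  by have := av (inner a) (inner b) (inner c); rewrite !encloseE !innerE.
have lt (d : 'I_n) := ltn_ord d.
case: (encloseP _ a) => [|a'||]; rewrite ?encloseE;
  case: (encloseP _ b) => [|b'||]; rewrite ?encloseE;
  case: (encloseP _ c) => [|c'||]; rewrite ?encloseE ?innerE ?enclose_fixpointE //=;
  rewrite ?ltnS; first [exact: av | move=> *].
all: try have := lt b'; try have := lt (t b'); try have := lt c'; try have := lt (t c'); lia.
Qed.

Lemma extend_max_lift n (t : 'S_n) i : extend_max t (lift ord_max i) = lift ord_max (t i).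
Proof. exact: lift_perm_lift. Qed.

Lemma extend_max_last n (t : 'S_n) : extend_max t ord_max = ord_max.
Proof. exact: lift_perm_id. Qed.

Definition extend_maxE := (extend_max_lift, extend_max_last).

Lemma extend_max_involution n (t : 'S_n) : involution (extend_max t) = involution t.
Proof.
apply/involutionP/involutionP => [sK i | tK y].
  by apply: (@lift_inj _ ord_max); rewrite -!extend_max_lift sK.
by case: (unliftP ord_max y) => [i|] ->; rewrite !extend_maxE ?tK.
Qed.

Lemma extend_max_avoids132 n (t : 'S_n) :
  avoids pattern132 (extend_max t) = avoids pattern132 t.
Proof.
apply/avoids132P/avoids132P => av a b c.
  have := av (lift ord_max a) (lift ord_max b) (lift ord_max c).
  by rewrite !extend_maxE !lift_max.
have lt (d : 'I_n) := ltn_ord d.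
case: (unliftP ord_max a) => [a'|] ->; rewrite ?extend_maxE;
  case: (unliftP ord_max b) => [b'|] ->; rewrite ?extend_maxE;
  case: (unliftP ord_max c) => [c'|] ->; rewrite ?extend_maxE ?lift_max /=;
  first [exact: av | move=> *].
all: try have := lt b'; try have := lt (t b'); try have := lt c'; try have := lt (t c'); lia.
Qed.

(** * Unique occurrences under the two constructions *)

Lemma enclose_rising n (t : 'S_n) q :
  pairwise (rising (enclose t)) (map inner q) = pairwise (rising t) q.
Proof.
by rewrite pairwise_map; apply: eq_pairwise => a b; rewrite /= /rising !enclose_inner !innerE.
Qed.

Lemma extend_max_rising n (t : 'S_n) q :
  pairwise (rising (extend_max t)) (map (lift ord_max) q) = pairwise (rising t) q.
Proof.
rewrite pairwise_map; apply: eq_pairwise => a b.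
by rewrite /= /rising !extend_maxE !lift_max.
Qed.

Lemma map_surj_in (aT : Type) (rT : eqType) (f : aT -> rT) (r : seq rT) :
  {in r, forall y, exists x, y = f x} -> exists q, r = map f q.
Proof.
elim: r => [|y r IHr] f_surj; first by exists [::].
have [x ->] := f_surj y (mem_head _ _).
have [z r_z|q ->] := IHr; first by apply: f_surj; rewrite inE r_z orbT.
by exists (x :: q).
Qed.

(** A trailing maximum cannot be the smallest entry, since a member of the nonempty [p] lies above
    it, nor can it stand to the left of that entry. *)
Lemma extend_max_occurrence n (t : 'S_n) p x : p != [::] ->
  occurs_23k1 (extend_max t) p x ->
  exists q y, [/\ p = map (lift ord_max) q, x = lift ord_max y & occurs_23k1 t q y].
Proof.
move=> p_neq0 /andP[pw /allP fa].
have [y def_x] : exists y, x = lift ord_max y.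
  case: (unliftP ord_max x) => [y|] def_x; first by exists y.
  case: p p_neq0 pw fa => // a p _ _ /(_ a (mem_head _ _)) /andP[_].
  by rewrite def_x extend_max_last ltnNge -ltnS ltn_ord.
have [z p_z|q def_p] := @map_surj_in _ _ (lift ord_max) p.
  case: (unliftP ord_max z) => [i|] def_z; first by exists i.
  by have /andP[] := fa z p_z; rewrite def_z ltnNge -ltnS ltn_ord.
exists q, y; split=> //; rewrite /occurs_23k1 -extend_max_rising -def_p pw.
apply/allP => i q_i; have /fa : lift ord_max i \in p by rewrite def_p map_f.
by rewrite /falling def_x !extend_maxE !lift_max.
Qed.

Lemma extend_max_once n m (t : 'S_n) : 0 < m ->
  contains_exactly (pattern23k1 m.+1) 1 (extend_max t)
  = contains_exactly (pattern23k1 m.+1) 1 t.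
Proof.
move=> m_gt0.
have neq0 (T : eqType) (p : seq T) : size p = m -> p != [::].
  by move=> sz_p; rewrite -size_eq0 sz_p -lt0n.
have up q y : occurs_23k1 t q y ->
    occurs_23k1 (extend_max t) (map (lift ord_max) q) (lift ord_max y).
  rewrite /occurs_23k1 extend_max_rising all_map => /andP[-> fa] /=.
  apply: sub_all fa => i; rewrite /= /falling !extend_maxE !lift_max //.
apply/contains_23k1_onceP/contains_23k1_onceP.
  case=> -[p x] [/= [sz_p occ] uniq_p].
  have [q [y [def_p def_x occ_q]]] := extend_max_occurrence _ _ _ _ (neq0 _ _ sz_p) occ.
  exists (q, y); split=> [|[q2 y2] /= [sz_q2 occ2]].
    by split=> //=; rewrite -sz_p def_p size_map.
  have [] : (p, x) = (map (lift ord_max) q2, lift ord_max y2).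
    by apply: uniq_p; rewrite /= size_map; split=> //; apply: up.
  rewrite def_p def_x => /(inj_map (@lift_inj _ _)) -> eq_y; congr (_, _).
  exact: (@lift_inj _ ord_max).
case=> -[q y] [/= [sz_q occ] uniq_q].
exists (map (lift ord_max) q, lift ord_max y).
split=> [|[p x] /= [sz_p occ_p]]; first by rewrite /= size_map; split=> //; apply: up.
have [q2 [y2 [def_p def_x occ_q]]] := extend_max_occurrence _ _ _ _ (neq0 _ _ sz_p) occ_p.
have [-> ->] : (q, y) = (q2, y2).
  by apply: uniq_q; split=> //=; rewrite -sz_p def_p size_map.
by rewrite def_p def_x.
Qed.

(** A position in [p] has [y] after it with a larger value, and [x] after that. This rules out the
    leading maximum and the last two positions. For [y] only the first and last positions are ruled
    out, so the fixed point remains possible. *)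
Lemma enclose_occurrence n (t : 'S_n) p y x : p != [::] ->
  occurs_23k1 (enclose t) (rcons p y) x ->
  exists q, [/\ p = map inner q, pairwise (rising t) q &
                 y = enclose_fixpoint \/ exists z, y = inner z].
Proof.
rewrite /occurs_23k1 pairwise_rcons all_rcons.
move=> p_neq0 /andP[/andP[/allP ri pw] /andP[/andP[lt_yx _] /allP fa]].
have y_lt : y < n.+2 by have := ltn_ord x; lia.
have [u p_u|q def_p] := @map_surj_in _ _ inner p.
  have := ri u p_u; rewrite /rising; case: (encloseP _ u) => [|i||] /andP[lt_u lt_su].
  - by move: lt_su; rewrite encloseE ltnNge -ltnS ltn_ord.
  - by exists i.
  - by move: lt_u y_lt; rewrite enclose_fixpointE; lia.
  - by move: lt_u y_lt => /=; lia.
exists q; split=> //; first by rewrite -(enclose_rising _ t) -def_p.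
case: (encloseP _ y) ri y_lt => [ri _|z||ri]; [|by right; exists z|by left|by rewrite /= ltnn].
by case: p p_neq0 ri {pw fa def_p} => // a p _ /(_ a (mem_head _ _)) /andP[].
Qed.

(** Appending the fixed point and the trailing minimum turns a rising sequence of [t] into an
    occurrence. In the other direction, uniqueness in [t] has to exclude occurrences whose entries
    [2, .., k] all lie in [t]. *)
Lemma enclose_once n m (t : 'S_n) : 0 < m ->
  contains_exactly (pattern23k1 m.+2) 1 (enclose t) = contains_exactly (pattern_id m) 1 t.
Proof.
move=> m_gt0.
have neq0 (T : eqType) (p : seq T) : size p = m -> p != [::].
  by move=> sz_p; rewrite -size_eq0 sz_p -lt0n.
have up q : pairwise (rising t) q ->
    occurs_23k1 (enclose t) (rcons (map inner q) enclose_fixpoint) ord_max.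
  move=> pw; rewrite /occurs_23k1 pairwise_rcons enclose_rising pw all_rcons !all_map.
  rewrite andbT; apply/andP; split.
    by apply/allP => i _; rewrite /= /rising !encloseE !innerE enclose_fixpointE !ltnS !ltn_ord.
  rewrite /= {1}/falling !encloseE enclose_fixpointE /= ltnSn; apply/allP => i _.
  by rewrite /= /falling !encloseE !innerE /= !ltnS ltnW.
apply/contains_23k1_onceP/contains_id_onceP.
  case=> -[p' x] [/= [sz_p occ] uniq_p].
  case/lastP: p' sz_p occ uniq_p => // p y; rewrite size_rcons => -[sz_p] occ uniq_p.
  have [q [def_p pw_q _]] := enclose_occurrence _ _ _ _ _ (neq0 _ _ sz_p) occ.
  exists q; split=> [|q2 [sz_q2 pw_q2]]; first by rewrite -sz_p def_p size_map.
  have [] : (rcons p y, x) = (rcons (map inner q2) enclose_fixpoint, ord_max).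
    by apply: uniq_p; rewrite /= size_rcons size_map sz_q2; split=> //; apply: up.
  by case/rcons_inj; rewrite def_p => /(inj_map (@inner_inj _)).
case=> q [[sz_q pw_q] uniq_q].
exists (rcons (map inner q) enclose_fixpoint, ord_max).
split=> [|[p' x] /= [sz_p occ]].
  by rewrite /= size_rcons size_map sz_q; split=> //; apply: up.
case/lastP: p' sz_p occ => // p y; rewrite size_rcons => -[sz_p] occ.
have [q2 [def_p pw_q2 y_or]] := enclose_occurrence _ _ _ _ _ (neq0 _ _ sz_p) occ.
have eq_q : q = q2 by apply: uniq_q; rewrite -sz_p def_p size_map.
case: y_or => [def_y | [z def_y]].
  (* Only the last position lies to the right of the fixed point. *)
  have -> : x = ord_max; last by rewrite def_p eq_q def_y.
  have /andP[_ /allP/(_ y)] := occ; rewrite mem_rcons mem_head => /(_ isT)/andP[+ _].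
  rewrite def_y enclose_fixpointE => lt_x; apply: ord_inj => /=; have := ltn_ord x; lia.
(* Otherwise [rcons q z] is a rising sequence of length [m + 1], and dropping
   its first entry gives a second rising sequence of length [m]. *)
have pw_z : pairwise (rising t) (rcons q z).
  by have /andP[+ _] := occ; rewrite def_p def_y -map_rcons enclose_rising eq_q.
case: {def_p} q sz_q pw_q uniq_q eq_q pw_z => [|c q] sz_q pw_q uniq_q eq_q pw_z.
  by rewrite -sz_q in m_gt0.
have eq_cq : c :: q = rcons q z.
  apply: uniq_q; rewrite size_rcons; split=> //.
  by move: pw_z; rewrite /= => /andP[].
have z_in : z \in c :: q by rewrite eq_cq mem_rcons mem_head.
move: pw_z; rewrite pairwise_rcons => /andP[/allP/(_ z z_in)].
by rewrite /rising ltnn.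
Qed.

(** * Inversions and parity *)

Lemma card_inversions n (s : 'S_n) :
  #|inversions s| = \sum_(i < n) \sum_(j < n) ((i < j) && (s j < s i)).
Proof.
rewrite pair_bigA /= -sum1_card big_mkcond /=.
by apply: eq_bigr => -[i j] _; rewrite inE /=; case: ifP.
Qed.

(** The two sums collect the inversions whose left, respectively right, member is the inserted
    entry. *)
Lemma card_inversions_lift_perm n (i j : 'I_n.+1) (t : 'S_n) :
  #|inversions (lift_perm i j t)|
  = \sum_k ((i < lift i k) && (lift j (t k) < j))
    + \sum_k ((lift i k < i) && (j < lift j (t k))) + #|inversions t|.
Proof.
have ltn_lift m (h : 'I_m.+1) (a b : 'I_m) : (lift h a < lift h b) = (a < b).
  by rewrite /= /bump; lia.
rewrite !card_inversions (bigD1_ord i) //= (bigD1_ord i) //= ltnn /= add0n -addnA.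
congr (_ + _); first by apply: eq_bigr => k _; rewrite lift_perm_lift lift_perm_id.
rewrite -big_split; apply: eq_bigr => k _ /=.
rewrite (bigD1_ord i) //= lift_perm_id lift_perm_lift; congr (_ + _).
by apply: eq_bigr => l _; rewrite lift_perm_lift !ltn_lift.
Qed.

Lemma card_inversions_extend_max n (t : 'S_n) :
  #|inversions (extend_max t)| = #|inversions t|.
Proof.
rewrite card_inversions_lift_perm !big1 // => k _;
  by rewrite !lift_max /= (leq_gtF (ltnW (ltn_ord _))) ?andbF.
Qed.

(** The leading maximum is inverted with all [n + 2] other entries, the trailing minimum with the
    [n + 1] remaining ones, and the fixed point adds nothing further. *)
Lemma card_inversions_enclose n (t : 'S_n) :
  #|inversions (enclose t)| = n.+2 + (n.+1 + #|inversions t|).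
Proof.
rewrite 2!card_inversions_lift_perm card_inversions_extend_max.
rewrite (eq_bigr (fun=> 1)) => [|k _]; last by rewrite lift_max lift0 /= ltn_ord.
rewrite [X in _ + X + _]big1 // [X in _ + (X + _ + _)]big1; last first.
  by move=> k _; rewrite lift0 ltn0 andbF.
rewrite [X in _ + (_ + X + _)](eq_bigr (fun=> 1)) => [|k _]; last first.
  by rewrite lift_max lift0 /= ltn_ord.
by rewrite !sum_nat_const !card_ord !muln1 addn0 add0n.
Qed.

Lemma enclose_even n (t : 'S_n) : even_permutation (enclose t) = odd_permutation t.
Proof.
rewrite /even_permutation card_inversions_enclose !oddD /= /odd_permutation.
by case: (odd n); case: (odd _).
Qed.

(** * The recurrence for the even counts *)

Lemma card_extend_max m n : 0 < m ->
  #|[set s : 'S_n.+1 | [&& involution s, even_permutation s, avoids pattern132 s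
      & contains_exactly (pattern23k1 m.+1) 1 s] && (s ord_max == ord_max)]|
  = I_even (pattern23k1 m.+1) 1 n.
Proof.
move=> m_gt0; rewrite /I_even -(card_imset _ (@lift_perm_inj n ord_max ord_max)).
apply: eq_card => s; rewrite inE; apply/andP/imsetP.
  case=> good /eqP/lift_perm_surj[t def_s]; exists t => //.
  move: good; rewrite inE def_s -/(extend_max t) extend_max_involution extend_max_avoids132.
  by rewrite extend_max_once // /even_permutation card_inversions_extend_max.
case=> t; rewrite inE => good ->; rewrite lift_perm_id eqxx; split=> //.
rewrite -/(extend_max t) extend_max_involution extend_max_avoids132.
by rewrite extend_max_once // /even_permutation card_inversions_extend_max.
Qed.

Lemma enclose_inj n : injective (@enclose n).
Proof. by move=> s t /lift_perm_inj/lift_perm_inj/lift_perm_inj. Qed.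

Lemma shape_of_moved_max m n (s : 'S_n.+1) : 0 < m ->
    involution s -> avoids pattern132 s ->
    contains_exactly (pattern23k1 m.+2) 1 s -> s ord_max != ord_max ->
  [/\ 1 < n, s ord0 = ord_max, s ord_max = ord0 & forall l : 'I_n.+1, l.+1 = n -> s l = l].
Proof.
move=> m_gt0 /involutionP sK /avoids132P av /contains_23k1_onceP[[p x] [[/= sz_p occ] uniq_p]] sN.
have [|q y sz_q occ_q|n_gt1 s0 sl] := unique_occurrence_shape n s p x sK _ av occ _ sN.
- by rewrite sz_p.
- by apply: uniq_p; rewrite /= sz_q sz_p.
- by split=> //; rewrite -s0 sK.
Qed.

Lemma card_enclose m n : 0 < m ->
  #|[set s : 'S_n.+3 | [&& involution s, even_permutation s, avoids pattern132 s
      & contains_exactly (pattern23k1 m.+2) 1 s] && (s ord_max != ord_max)]|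
  = I_odd (pattern_id m) 1 n.
Proof.
move=> m_gt0; rewrite /I_odd -(card_imset _ (@enclose_inj n)).
have goodE (t : 'S_n) : [&& involution (enclose t), even_permutation (enclose t),
        avoids pattern132 (enclose t) & contains_exactly (pattern23k1 m.+2) 1 (enclose t)]
    = [&& involution t, odd_permutation t, avoids pattern132 t
        & contains_exactly (pattern_id m) 1 t].
  by rewrite enclose_involution enclose_even enclose_avoids132 enclose_once.
apply: eq_card => s; rewrite inE; apply/andP/imsetP.
  case=> good sN; have /and4P[sK _ av once] := good.
  have [_ s0 sN0 sl] := shape_of_moved_max _ _ _ m_gt0 sK av once sN.
  have [|t def_s] := enclose_surj _ s s0 sN0.
    by apply: sl; rewrite enclose_fixpointE.
  by exists t; rewrite // inE -goodE -def_s.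
by case=> t; rewrite inE -goodE => good ->; rewrite enclose_last.
Qed.

(** Split according to whether the last position is fixed. If so, deleting it leaves length [n]; if
    not, the permutation is enclosed and its core has length [n + 1 - 3], which requires [1 < n]. *)
Lemma I_evenS m n : 0 < m ->
  I_even (pattern23k1 m.+2) 1 n.+1
  = I_even (pattern23k1 m.+2) 1 n + (if 1 < n then I_odd (pattern_id m) 1 (n - 2) else 0).
Proof.
move=> m_gt0; rewrite -(card_extend_max _ n) // {1}/I_even.
rewrite -(cardsID [set s : 'S_n.+1 | s ord_max == ord_max] [set s | _]); congr (_ + _).
  by apply: eq_card => s; rewrite !inE.
case: ltnP => [|n_le1].
  case: n => [|[|n]] // _; rewrite -card_enclose // subn2 /=.
  by apply: eq_card => s; rewrite !inE andbC.
apply/eqP; rewrite cards_eq0; apply/eqP/setP => s; rewrite !inE.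
apply/negP => /andP[sN /and4P[sK _ av once]].
by have [] := shape_of_moved_max _ _ _ m_gt0 sK av once sN; rewrite ltnNge n_le1.
Qed.

Lemma I_even0 m : I_even (pattern23k1 m.+1) 1 0 = 0.
Proof.
apply/eqP; rewrite cards_eq0; apply/eqP/setP => s; rewrite !inE.
by apply/negP => /and4P[_ _ _ /contains_23k1_onceP[[_ x] _]]; case: x.
Qed.

(** Unrolled recurrence: [j] is the length of the enclosed core and [n - 3 - j] the number of fixed
    points in the tail. *)
Lemma I_even_sum m n : 0 < m ->
  I_even (pattern23k1 m.+2) 1 n = \sum_(j < n - 2) I_odd (pattern_id m) 1 j.
Proof.
move=> m_gt0; elim: n => [|n IHn]; first by rewrite I_even0 big_ord0.
rewrite I_evenS // IHn; case: ltnP => [n_gt1 | n_le1].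
  by rewrite subSn // big_ord_recr.
(* As [n <= 1], both truncated differences are 0. *)
by rewrite addn0 (_ : n.+1 - 2 = n - 2) //; lia.
Qed.

(** * Translation into power series *)

Local Open Scope ring_scope.

(** Geometric series: multiplying by [1 - X] takes differences of consecutive coefficients, so an
    inverse starts with 1 and stays constant. *)
Lemma fps_inv_1subX (F : fieldType) (n : nat) : fps_inv (fps_of_poly (1 - 'X : {poly F})) n = 1.
Proof.
have f0 : fps_of_poly (1 - 'X : {poly F}) 0%N != 0.
  by rewrite /fps_of_poly coefB coef1 coefX subr0 oner_neq0.
elim: n => [|n IHn]; have := fps_mulV f0.
  move/(_ 0%N); rewrite /fps_mul big_ord1 /fps_of_poly coefB !coef1 coefX.
  by rewrite subr0 mul1r.
move/(_ n.+1); rewrite /fps_mul !big_ord_recl big1 => [|i _].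
  rewrite /fps_of_poly !coefB !coef1 !coefX /= subr0 sub0r mul1r mulN1r addr0.
  by rewrite subn0 subSS subn0 IHn => /eqP; rewrite subr_eq0 => /eqP.
by rewrite /fps_of_poly coefB coef1 coefX subrr mul0r.
Qed.

Lemma fps_div_Xn_1subX (F : fieldType) (d n : nat) :
  fps_div (fps_of_poly ('X^d : {poly F})) (fps_of_poly (1 - 'X)) n = (d <= n)%N%:R.
Proof.
rewrite /fps_div /fps_mul.
under eq_bigr => i _ do rewrite fps_inv_1subX mulr1 /fps_of_poly coefXn.
case: (leqP d n) => [le_dn | lt_nd].
  rewrite (bigD1 (Ordinal (le_dn : (d < n.+1)%N))) //= eqxx big1 ?addr0 // => i.
  by rewrite -(inj_eq val_inj) /= => /negPf->.
by rewrite big1 // => i _; rewrite ltn_eqF //; have := ltn_ord i; lia.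
Qed.

Theorem theorem3p15 (k : nat) (hk : (3 <= k)%N) :
  gen_series (fun n => I_even (pattern23k1 k) 1 n)
  =1 fps_mul (fps_div (fps_of_poly 'X^3) (fps_of_poly (1 - 'X)))
             (gen_series (fun n => I_odd (pattern_id (k - 2)%N) 1 n)).
Proof.
case: k hk => [|[|m]] // m_gt0 n; rewrite subn2 /gen_series I_even_sum //= natr_sum.
rewrite /fps_mul; under [RHS]eq_bigr => i _ do rewrite fps_div_Xn_1subX.
(* Reversing the sum makes the argument of [I_odd] the summation index, up to the simplification of
   [n - (n.+1 - i.+1)]. *)
rewrite [RHS](reindex_inj rev_ord_inj) /=.
rewrite -(big_mkord xpredT (fun i => (2 < n.+1 - i.+1)%N%:R
  * (I_odd (pattern_id m) 1 (n - (n.+1 - i.+1)))%:R : rat)).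
(* The coefficient of [X^3 / (1 - X)] at [n - i] is 1 exactly when [i < n - 2], so the second part
   of the sum vanishes. *)
rewrite (@big_cat_nat _ _ _ (n - 2)) //=; last by lia.
rewrite [X in _ = _ + X]big_nat_cond [X in _ = _ + X]big1 ?addr0 => [|i /andP[lt_i _]].
  rewrite -(big_mkord xpredT (fun i => (I_odd (pattern_id m) 1 i)%:R : rat)).
  apply: eq_big_nat => i lt_i; rewrite (_ : (2 < _)%N = true) ?mul1r; last by lia.
  by congr (I_odd _ _ _)%:R; lia.
by rewrite (_ : (2 < _)%N = false) ?mul0r //; lia.
Qed.
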